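(* Let $\bullet$ be the unlabelled single-vertex tree, and let $W(\bullet)$ be its pre-Lie exponential with respect to the edge-insertion pre-Lie product $\triangleleft$ on unlabelled nonplanar rooted binary trees. Then for every unlabelled nonplanar rooted binary tree $T$, the coefficient of $T$ in $W(\bullet)$ is $1/s_T$, where $s_T$ is the number of automorphisms of $T$.
   Context: A (nonplanar rooted) binary tree is a finite rooted tree, without a planar embedding, in which every vertex has either $0$ or $2$ children; trees here are unlabelled and taken up to root-preserving isomorphism, and the single-vertex tree $\bullet$ is included. $s_T$ is the order of the group of root-preserving graph automorphisms of $T$. Let $k$ be a field of characteristic $0$ and $k\{\mathcal{T}\}$ the vector space with basis the set $\mathcal{T}$ of (isomorphism classes of) binary trees. For trees $T,S$ and an edge $e\in E(T)$, $T\triangleleft_e S$ is the tree obtained by splitting $e$ by a new vertex and joining the root of $S$ to it by a new edge. $\mathfrak{M}(T,S)$ is the tree whose root has the two child subtrees $T$ and $S$. Set $T\triangleleft S=\mathfrak{M}(T,S)+\sum_{e\in E(T)}T\triangleleft_e S$, extended bilinearly; this is a right pre-Lie product on $k\{\mathcal{T}\}$. The pre-Lie exponential of $x$ is the formal series $$W(x)=x+\frac{1}{2!}\,x\triangleleft x+\frac1{3!}\,(x\triangleleft x)\triangleleft x+\cdots.$$ Thus $W(\bullet)=\sum_{k\ge1}\frac1{k!}\mathfrak{N}^{k-1}(\bullet)$, where $\mathfrak{N}(T)=T\triangleleft\bullet$ and $\mathfrak{N}^0(\bullet)=\bullet$; it is a formal (infinite) linear combination of binary trees. *)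

(* Defs.v *)
From HB Require Import structures.
From mathcomp Require Import all_boot all_order all_algebra.
From mathcomp Require Import perm generic_quotient finmap.
From mathcomp.multinomials Require Import monalg.

Set Implicit Arguments.
Unset Strict Implicit.
Unset Printing Implicit Defensive.

Import GRing.Theory.
Local Open Scope ring_scope.

(* Planar representatives.  A binary tree is an isomorphism class of these,
   isomorphism being that of the underlying rooted graphs (see [btree]). *)
Inductive ptree := Leaf | Node of ptree & ptree.

Fixpoint ptree_encode (t : ptree) : GenTree.tree void :=
  if t is Node l r then GenTree.Node 1 [:: ptree_encode l; ptree_encode r]
  else GenTree.Node 0 [::].

Fixpoint ptree_decode (t : GenTree.tree void) : ptree :=
  if t is GenTree.Node 1 [:: l; r] then Node (ptree_decode l) (ptree_decode r)
  else Leaf.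

Lemma ptree_encodeK : cancel ptree_encode ptree_decode.
Proof. by elim=> //= l -> r ->. Qed.

HB.instance Definition _ := Countable.copy ptree (can_type ptree_encodeK).

(* A vertex is named by the sequence of left (false) / right (true) turns
   leading to it from the root, which is [::]. *)
Fixpoint addresses (t : ptree) : seq (seq bool) :=
  if t is Node l r then
    [::] :: map (cons false) (addresses l) ++ map (cons true) (addresses r)
  else [:: [::]].

Definition vertex (t : ptree) : finType := seq_sub (addresses t).

Lemma root_subproof (t : ptree) : [::] \in addresses t.
Proof. by case: t => *; rewrite inE. Qed.

Definition root_vertex (t : ptree) : vertex t := SeqSub (root_subproof t).

Definition is_child (t : ptree) (x y : vertex t) : bool :=
  [exists b : bool, val y == rcons (val x) b].

Definition adjacent (t : ptree) (x y : vertex t) : bool :=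
  is_child x y || is_child y x.

(* Each edge is written (parent, child). *)
Definition edges (t : ptree) : {set vertex t * vertex t} :=
  [set e | is_child e.1 e.2].

Definition isomorphic (t s : ptree) : Prop :=
  exists f : vertex t -> vertex s,
    [/\ bijective f, f (root_vertex t) = root_vertex s &
        forall x y, adjacent (f x) (f y) = adjacent x y].

Definition automorphisms (t : ptree) : {set {perm vertex t}} :=
  [set g : {perm vertex t} | (g (root_vertex t) == root_vertex t) &&
     [forall x, forall y, adjacent (g x) (g y) == adjacent x y]].

Definition isob (t s : ptree) : bool :=
  [exists f : {ffun vertex t -> vertex s}, exists g : {ffun vertex s -> vertex t},
    [&& [forall x, g (f x) == x], [forall y, f (g y) == y],
        f (root_vertex t) == root_vertex s &
        [forall x, forall y, adjacent (f x) (f y) == adjacent x y]]].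

Lemma isoP (t s : ptree) : reflect (isomorphic t s) (isob t s).
Proof.
apply: (iffP existsP) => [[f /existsP[g /and4P[fg gf /eqP f0 fa]]]|].
  exists f; split=> //; last by move=> x y; apply/eqP/(forallP (forallP fa x) y).
  by exists g => x; apply/eqP; [exact: (forallP fg)|exact: (forallP gf)].
case=> f [[g fg gf] f0 fa]; exists (finfun f); apply/existsP; exists (finfun g).
rewrite !ffunE f0 eqxx /=; apply/and3P; split.
- by apply/forallP => x; rewrite !ffunE fg.
- by apply/forallP => x; rewrite !ffunE gf.
- by apply/forallP => x; apply/forallP => y; rewrite !ffunE fa.
Qed.

Lemma isob_refl : reflexive isob.
Proof. by move=> t; apply/isoP; exists id; split=> //; exists id. Qed.

Lemma isob_sym : symmetric isob.
Proof.
suff sub t s : isob t s -> isob s t by move=> t s; apply/idP/idP; apply: sub.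
move=> /isoP[f [[g fg gf] f0 fa]]; apply/isoP; exists g; split.
- by exists f.
- by rewrite -f0 fg.
- by move=> x y; rewrite -fa !gf.
Qed.

Lemma isob_trans : transitive isob.
Proof.
move=> s t u /isoP[f [bf f0 fa]] /isoP[g [bg g0 ga]]; apply/isoP.
exists (g \o f); split; first exact: bij_comp.
- by rewrite /= f0.
- by move=> x y; rewrite /= ga fa.
Qed.

Canonical isob_equiv := EquivRel isob isob_refl isob_sym isob_trans.

Definition btree : Type := {eq_quot isob}%qT.
HB.instance Definition _ := Choice.on btree.
HB.instance Definition _ := EqQuotient.on btree.

(* The operations below are computed on the representative [repr T]; none of
   them depends on the choice of a representative. *)

Definition bullet : btree := (\pi_btree Leaf)%qT.

Definition nb_aut (T : btree) : nat := #|automorphisms (repr T)|.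

Definition nb_vertices (T : btree) : nat := #|vertex (repr T)|.

Definition join_trees (T S : btree) : btree := (\pi_btree (Node (repr T) (repr S)))%qT.

(* Replaces the subtree t_p of t at p by the tree with children t_p and s.
   When p is not the root, this splits the edge just above p and joins the
   root of s to the new vertex. *)
Fixpoint split_above (t : ptree) (p : seq bool) (s : ptree) : ptree :=
  match p, t with
  | [::], _ => Node t s
  | false :: q, Node l r => Node (split_above l q s) r
  | true :: q, Node l r => Node l (split_above r q s)
  | _ :: _, Leaf => Leaf
  end.

Definition insert_at (T : btree) (e : vertex (repr T) * vertex (repr T))
    (S : btree) : btree :=
  (\pi_btree (split_above (repr T) (val e.2) (repr S)))%qT.

Section PreLie.
Variable k : fieldType.
Implicit Types x y : {malg k[btree]}.

Definition prelie_basis (T S : btree) : {malg k[btree]} :=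
  << join_trees T S >> + \sum_(e in edges (repr T)) << insert_at e S >>.

Definition prelie x y : {malg k[btree]} :=
  \sum_(T <- msupp x) \sum_(S <- msupp y) (x@_T * y@_S) *: prelie_basis T S.

(* (..((x <| x) <| x)..) <| x, with n+1 occurrences of x. *)
Definition prelie_pow x (n : nat) : {malg k[btree]} :=
  iter n (fun z => prelie z x) x.

(* Formal linear combinations of trees are functions btree -> k.  The trees
   occurring in the n-th term of W(x) (counting from 0) have more than n
   vertices, so that the coefficient at T is a finite sum: see prelie_expE. *)
Definition prelie_exp x : btree -> k := fun T =>
  \sum_(n < nb_vertices T) ((n.+1)`!%:R^-1 *: prelie_pow x n)@_T.

Lemma size_addresses_gt0 t : (0 < size (addresses t))%N.
Proof. by case: t. Qed.

Lemma addresses_uniq t : uniq (addresses t).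
Proof.
elim: t => //= l IHl r IHr; rewrite mem_cat negb_or cat_uniq.
rewrite !map_inj_uniq ?IHl ?IHr => [|u v []//|u v []//].
rewrite andbT -andbA; apply/and3P; split=> //.
- by apply/negP => /mapP[].
- by apply/negP => /mapP[].
- by apply/hasPn => u /mapP[v _ ->]; apply/negP => /mapP[].
Qed.

Lemma card_vertex t : #|vertex t| = size (addresses t).
Proof. by rewrite card_seq_sub // addresses_uniq. Qed.

Lemma nb_vertices_pi t : nb_vertices (\pi_btree t)%qT = #|vertex t|.
Proof.
have /isoP[f [bf _ _]] : isob (repr (\pi_btree t)%qT) t.
  by rewrite -(pi_eq_quot (s := btree)) reprK.
exact: bij_eq_card bf.
Qed.

Lemma size_split_above t p s : p \in addresses t ->
  size (addresses (split_above t p s)) =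
  (size (addresses t) + size (addresses s)).+1.
Proof.
elim: t p => [|l IHl r IHr] [|b p] //=; rewrite ?size_cat ?size_map //.
  by rewrite size_cat !size_map addSn.
rewrite inE /= mem_cat => /orP[] /mapP[q qP [-> ->]] /=;
  rewrite size_cat !size_map ?(IHl _ qP) ?(IHr _ qP).
  by rewrite !addSn; congr _.+2; rewrite addnAC.
by rewrite addnS addnA.
Qed.

Lemma nb_vertices_join T S : (nb_vertices T < nb_vertices (join_trees T S))%N.
Proof.
rewrite /join_trees nb_vertices_pi /nb_vertices !card_vertex /= size_cat !size_map.
by rewrite ltnS leq_addr.
Qed.

Lemma nb_vertices_insert T (e : vertex (repr T) * vertex (repr T)) S :
  (nb_vertices T < nb_vertices (insert_at e S))%N.
Proof.
rewrite /insert_at nb_vertices_pi /nb_vertices !card_vertex.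
by rewrite size_split_above ?ltnS ?leq_addr //; exact: valP.
Qed.

Lemma prelie_pow_supp x n T : (nb_vertices T <= n)%N -> (prelie_pow x n)@_T = 0.
Proof.
elim: n T => [|n IHn] T.
  by rewrite leqn0 /nb_vertices card_vertex -[_ == _]negbK -lt0n size_addresses_gt0.
move=> Tn; rewrite /= -/(prelie_pow x n) /prelie raddf_sum big1 // => U _.
rewrite raddf_sum big1 // => S _ /=; rewrite mcoeffZ.
have [/IHn->|nU] := leqP (nb_vertices U) n; first by rewrite !mul0r.
have neT V : (nb_vertices U < nb_vertices V)%N -> V == T = false.
  by move=> UV; apply/eqP => eVT; have := leq_trans UV; rewrite eVT => /(_ _ Tn);
    rewrite ltnS leqNgt nU.
rewrite /prelie_basis mcoeffD mcoeffU neT ?nb_vertices_join // add0r.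
rewrite raddf_sum big1 ?mulr0 // => e _ /=.
by rewrite mcoeffU neT ?nb_vertices_insert.
Qed.

Lemma prelie_expE x T N : (nb_vertices T <= N)%N ->
  prelie_exp x T = (\sum_(n < N) (n.+1)`!%:R^-1 *: prelie_pow x n)@_T.
Proof.
move=> leN; rewrite raddf_sum /prelie_exp /=.
rewrite (big_ord_widen_cond _ xpredT
  (fun n => ((n.+1)`!%:R^-1 *: prelie_pow x n)@_T) leN).
rewrite big_mkcond /=; apply: eq_bigr => n _; case: ltnP => // Tn.
by rewrite mcoeffZ prelie_pow_supp ?mulr0.
Qed.

End PreLie.

(* Main.v *)
Require Import Defs.
From mathcomp Require Import all_boot all_order all_algebra.
From mathcomp Require Import perm generic_quotient finmap.
From mathcomp.multinomials Require Import monalg.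
From mathcomp Require Import zify.

(* A planar binary tree t with n internal nodes admits 2^n choices of an order
   of the children at each node; each choice is an isomorphism onto a planar
   tree and every isomorphism from t arises once, so exactly 2^n / s_t planar
   trees are isomorphic to t.  Inserting a leaf next to the subtree at a vertex
   of a planar tree, on either side, is Remy's growth process: each planar tree
   with n+1 internal nodes is obtained n+2 times, once per leaf.  Hence the n-th
   power N^n(bullet) is (n+1)! / 2^n times the sum of all planar trees with n
   internal nodes, and its coefficient at T is (n+1)! / s_T. *)

Set Implicit Arguments.
Unset Strict Implicit.
Unset Printing Implicit Defensive.

Import GRing.Theory.

(** * Parents and children among the vertices of a planar tree *)

Lemma addresses_rcons t p b : rcons p b \in addresses t -> p \in addresses t.
Proof.
elim: t p => [|l IHl r IHr] [|c p] //=; rewrite ?inE //= !mem_cat.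
case/orP=> /mapP[q qP [-> qE]]; rewrite -qE in qP.
  by rewrite (map_f (cons _) (IHl _ qP)).
by rewrite (map_f (cons _) (IHr _ qP)) orbT.
Qed.

Lemma is_childP t (x y : vertex t) :
  reflect (exists b, val y = rcons (val x) b) (is_child x y).
Proof. by apply: (iffP existsP) => -[b xy]; exists b; apply/eqP. Qed.

(** Addresses are closed under dropping the last turn, so every vertex is reached from the root by
    steps to a child. *)
Lemma vertex_child_ind t (P : vertex t -> Prop) : P (root_vertex t) ->
  (forall x y, is_child x y -> P x -> P y) -> forall x, P x.
Proof.
move=> P0 PS [p pt]; elim/last_ind: p pt => [|p b IHp] pt.
  by rewrite (_ : SeqSub pt = root_vertex t) //; apply: val_inj.
by apply: PS (IHp (addresses_rcons pt)); apply/is_childP; exists b.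
Qed.

Lemma is_child_inj t (x y z : vertex t) : is_child x z -> is_child y z -> x = y.
Proof.
move=> /is_childP[b zE] /is_childP[c]; rewrite zE => /rcons_inj[xy _].
exact: val_inj.
Qed.

Lemma is_child_rootr t (x : vertex t) : is_child x (root_vertex t) = false.
Proof. by apply/is_childP => -[b]; case: (val x). Qed.

Lemma has_parent t (x : vertex t) :
  x = root_vertex t \/ exists y, is_child y x.
Proof. by elim/vertex_child_ind: x => [|x y xy _]; [left|right; exists x]. Qed.

Lemma card_parents t (y : vertex t) :
  #|[pred x | is_child x y]| = (y != root_vertex t).
Proof.
have [->|[x xy]] := has_parent y.
  by rewrite eqxx; apply: eq_card0 => x; rewrite inE is_child_rootr.
have -> : y != root_vertex t by apply: contraTneq xy => ->; rewrite is_child_rootr.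
rewrite -[RHS](card1 x); apply: eq_card => z; rewrite !inE.
by apply/idP/eqP => [/is_child_inj|->] //; apply.
Qed.

(** * Isomorphisms as injections that respect the child relation *)

(** Fixing the root orients every edge. From left to right, induction from the root shows that no
    edge is reversed. From right to left, the relation is also reflected, because a vertex has at
    most one parent. *)
Lemma adjacent_childP t s (f : vertex t -> vertex s) :
  injective f -> f (root_vertex t) = root_vertex s ->
  (forall x y, adjacent (f x) (f y) = adjacent x y) <->
  (forall x y, is_child x y -> is_child (f x) (f y)).
Proof.
move=> fI f0; split=> [fa x|fc x y].
  elim/vertex_child_ind: x => [|z x zx IHx] y xy.
    have := fa (root_vertex t) y; rewrite /adjacent xy f0 is_child_rootr.
    by rewrite orbF.
  have := fa x y; rewrite /adjacent xy => /orP[//|yx].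
  (* A reversed edge would give [f x] the two parents [f z] and [f y]; then [y] is both parent and
     child of [x], which the lengths of addresses exclude. *)
  have zy : z = y by apply: fI; apply: is_child_inj yx; apply: IHx.
  case/is_childP: xy => b; case/is_childP: zx => c ->; rewrite zy.
  by move/(congr1 size); rewrite !size_rcons; lia.
have sub u v : is_child (f u) (f v) = is_child u v.
  apply/idP/idP => [uv|/fc//].
  have [v0|[w wv]] := has_parent v; first by rewrite v0 f0 is_child_rootr in uv.
  by rewrite -(fI _ _ (is_child_inj (fc _ _ wv) uv)).
by rewrite /adjacent !sub.
Qed.

(* Preserving the child relation and the root amounts to preserving adjacency
   and the root (adjacent_childP); equal cardinals make injections bijective. *)
Definition isos t s : {set {ffun vertex t -> vertex s}} :=
  [set f : {ffun vertex t -> vertex s} | [&& #|vertex t| == #|vertex s|, injectiveb f,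
     f (root_vertex t) == root_vertex s &
     [forall x, forall y, is_child x y ==> is_child (f x) (f y)]]].

Lemma isosP t s (f : {ffun vertex t -> vertex s}) :
  reflect [/\ #|vertex t| = #|vertex s|, injective f,
     f (root_vertex t) = root_vertex s &
     forall x y, is_child x y -> is_child (f x) (f y)] (f \in isos t s).
Proof.
rewrite inE; apply: (iffP and4P) => -[/eqP cE /injectiveP fI /eqP f0 fc].
  by split=> // x y; apply/implyP; apply: (forallP (forallP fc x)).
split=> //; apply/forallP => x; apply/forallP => y.
by apply/implyP/fc.
Qed.

Lemma isobE t s : isob t s = (0 < #|isos t s|).
Proof.
apply/isoP/card_gt0P => [[f [bf f0 fa]]|[f /isosP[cE fI f0 fc]]].
  have fI := bij_inj bf.
  have fE : finfun f =1 f := ffunE f.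
  exists (finfun f); apply/isosP; split; rewrite ?fE //.
  - exact: bij_eq_card bf.
  - exact: eq_inj (fun x => esym (fE x)).
  - by move=> x y; rewrite !fE; apply: (adjacent_childP fI f0).1.
exists f; split=> //; last exact: (adjacent_childP fI f0).2.
by apply: inj_card_bij => //; rewrite cE.
Qed.

Lemma card_automorphisms t : #|automorphisms t| = #|isos t t|.
Proof.
have cI : injective (fun g : {perm vertex t} => [ffun x => g x]).
  by move=> g h /ffunP gh; apply/permP => x; have := gh x; rewrite !ffunE.
rewrite -(card_imset _ cI); apply: eq_card => f.
apply/imsetP/isosP => [[g]|[_ fI f0 fc]].
  rewrite inE => /andP[/eqP g0 ga] ->; split=> [//|x y||x y]; rewrite !ffunE //.
    exact: perm_inj.
  apply: (adjacent_childP (@perm_inj _ g) g0).1.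
  by move=> u v; apply/eqP/(forallP (forallP ga u)).
exists (perm fI); last by apply/ffunP => x; rewrite ffunE permE.
rewrite inE permE f0 eqxx; apply/forallP => x; apply/forallP => y.
by rewrite !permE; apply/eqP; apply: (adjacent_childP fI f0).2.
Qed.

(** Composition with a fixed isomorphism from [s] to [u] is injective. *)
Lemma card_isos_comp t s u : isob s u -> #|isos t s| <= #|isos t u|.
Proof.
rewrite isobE => /card_gt0P[h /isosP[hE hI h0 hc]].
have cI : injective (fun f : {ffun vertex t -> vertex s} => [ffun x => h (f x)]).
  move=> f g /ffunP fg; apply/ffunP => x; apply: hI.
  by have := fg x; rewrite !ffunE.
rewrite -(card_imset _ cI); apply/subset_leq_card/subsetP => h' /imsetP[f].
move=> /isosP[fE fI f0 fc] {h'}->; apply/isosP; split; rewrite ?[_ (root_vertex t)]ffunE ?f0 //.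
- by rewrite fE.
- by move=> x y; rewrite !ffunE => /hI/fI.
- by move=> x y /fc/hc; rewrite !ffunE.
Qed.

(** Either there is no isomorphism, or composition with one and with one in the other direction
    bounds each count by the other. *)
Lemma card_isos t s : #|isos t s| = isob t s * #|automorphisms t|.
Proof.
rewrite card_automorphisms; case: (boolP (isob t s)) => [ts|]; last first.
  by rewrite isobE lt0n negbK => /eqP.
by apply/eqP; rewrite mul1n eqn_leq !card_isos_comp // isob_sym.
Qed.

(** * The vertices of a node: its root and those of its two subtrees *)

Section NodeVertices.
Variables l r : ptree.

Lemma lvertex_subproof (u : vertex l) : false :: val u \in addresses (Node l r).
Proof. by rewrite inE /= mem_cat map_f // (valP u). Qed.

Lemma rvertex_subproof (u : vertex r) : true :: val u \in addresses (Node l r).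
Proof. by rewrite inE /= mem_cat orbC map_f // (valP u). Qed.

Definition lvertex u : vertex (Node l r) := SeqSub (lvertex_subproof u).
Definition rvertex u : vertex (Node l r) := SeqSub (rvertex_subproof u).

Definition vertex_of (o : option (vertex l + vertex r)) : vertex (Node l r) :=
  match o with
  | None => root_vertex _
  | Some (inl u) => lvertex u
  | Some (inr u) => rvertex u
  end.

(** [insub] never fails here: the tail of a nonempty address of [Node l r] is an address of the
    chosen subtree. *)
Definition vertex_case (x : vertex (Node l r)) : option (vertex l + vertex r) :=
  match val x with
  | [::] => None
  | false :: p => omap inl (insub p)
  | true :: p => omap inr (insub p)
  end.

Lemma vertex_ofK : cancel vertex_of vertex_case.
Proof. by case=> [[]|] // u; rewrite /vertex_case /= valK. Qed.

Lemma vertex_caseK : cancel vertex_case vertex_of.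
Proof.
move=> [p pP]; apply: val_inj; rewrite /vertex_case /=.
case: p pP => [|b p] //; rewrite inE mem_cat /=.
by case/orP=> /mapP[q qP [-> ->]]; rewrite insubT.
Qed.

Lemma card_vertex_Node : #|vertex (Node l r)| = (#|vertex l| + #|vertex r|).+1.
Proof.
rewrite -card_sum -card_option; apply: (bij_eq_card (f := vertex_case)).
by exists vertex_of; [exact: vertex_caseK|exact: vertex_ofK].
Qed.

Lemma is_child_ll u v : is_child (lvertex u) (lvertex v) = is_child u v.
Proof. by apply/is_childP/is_childP => -[b] => [[vE]|vE]; exists b; rewrite //= vE. Qed.

Lemma is_child_rr u v : is_child (rvertex u) (rvertex v) = is_child u v.
Proof. by apply/is_childP/is_childP => -[b] => [[vE]|vE]; exists b; rewrite //= vE. Qed.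

Lemma is_child_lr u v : is_child (lvertex u) (rvertex v) = false.
Proof. by apply/is_childP => -[b]. Qed.

Lemma is_child_rl u v : is_child (rvertex u) (lvertex v) = false.
Proof. by apply/is_childP => -[b]. Qed.

Lemma is_child_0l v : is_child (root_vertex _) (lvertex v) = (v == root_vertex l).
Proof.
apply/is_childP/eqP => [[b []]|->]; last by exists false.
by move=> _ v0; apply: val_inj.
Qed.

Lemma is_child_0r v : is_child (root_vertex _) (rvertex v) = (v == root_vertex r).
Proof.
apply/is_childP/eqP => [[b []]|->]; last by exists true.
by move=> _ v0; apply: val_inj.
Qed.

Lemma lvertex_inj : injective lvertex.
Proof. by move=> u v /(congr1 val)[/val_inj]. Qed.

Lemma rvertex_inj : injective rvertex.
Proof. by move=> u v /(congr1 val)[/val_inj]. Qed.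

End NodeVertices.

Definition is_childE :=
  (is_child_rootr, is_child_ll, is_child_rr, is_child_lr, is_child_rl,
   is_child_0l, is_child_0r).

(** * Counting isomorphisms between two nodes *)

Section Glue.
Variables l r l' r' : ptree.

Definition glue
    (gh : {ffun vertex l -> vertex l'} * {ffun vertex r -> vertex r'}) :
    {ffun vertex (Node l r) -> vertex (Node l' r')} :=
  [ffun x => match vertex_case x with
    | None => root_vertex _
    | Some (inl u) => lvertex r' (gh.1 u)
    | Some (inr u) => rvertex l' (gh.2 u)
    end].

Lemma glue0 gh : glue gh (root_vertex _) = root_vertex _.
Proof. by rewrite ffunE. Qed.

Lemma gluel gh u : glue gh (lvertex r u) = lvertex r' (gh.1 u).
Proof. by rewrite ffunE (vertex_ofK (Some (inl u))). Qed.

Lemma gluer gh u : glue gh (rvertex l u) = rvertex l' (gh.2 u).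
Proof. by rewrite ffunE (vertex_ofK (Some (inr u))). Qed.

Lemma glue_inj : injective glue.
Proof.
move=> [g h] [g' h'] /ffunP gh; congr pair; apply/ffunP => u.
  by have := gh (lvertex _ u); rewrite !gluel => /lvertex_inj.
by have := gh (rvertex _ u); rewrite !gluer => /rvertex_inj.
Qed.

(** An isomorphism that matches the left children also matches the right ones, hence restricts to
    each pair of subtrees; conversely, two such restrictions glue together. *)
Lemma isos_glue :
  [set f in isos (Node l r) (Node l' r') |
     f (lvertex r (root_vertex l)) == lvertex r' (root_vertex l')] =
  glue @: setX (isos l l') (isos r r').
Proof.
apply/setP => f; rewrite inE; apply/andP/imsetP; last first.
  case=> -[g h] /setXP[/isosP[gE gI g0 gc] /isosP[hE hI h0 hc]] ->.
  split; last by rewrite gluel g0.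
  apply/isosP; split; rewrite ?glue0 //.
  - by rewrite !card_vertex_Node gE hE.
  - move=> x y; rewrite -[x]vertex_caseK -[y]vertex_caseK.
    case: (vertex_case x) => [[]|] => [u|u|]; case: (vertex_case y) => [[]|] => [v|v|] /=;
      rewrite ?glue0 ?gluel ?gluer //.
      by move/lvertex_inj/gI->.
    by move/rvertex_inj/hI->.
  - move=> x y; rewrite -[x]vertex_caseK -[y]vertex_caseK.
    case: (vertex_case x) => [[]|] => [u|u|]; case: (vertex_case y) => [[]|] => [v|v|] /=;
      rewrite ?glue0 ?gluel ?gluer !is_childE //=; first exact: gc; first exact: hc.
      by move=> /eqP->; rewrite g0.
    by move=> /eqP->; rewrite h0.
case=> /isosP[cE fI f0 fc] /eqP fl0.
(* The image is a child of the root and, by injectivity, not the left one. *)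
have fr0 : f (rvertex l (root_vertex r)) = rvertex l' (root_vertex r').
  have : is_child (root_vertex _) (f (rvertex l (root_vertex r))).
    by rewrite -f0; apply: fc; rewrite is_childE.
  have : f (rvertex l (root_vertex r)) != f (lvertex r (root_vertex l)).
    by apply/eqP => /fI/(congr1 val).
  rewrite -[f (rvertex _ _)]vertex_caseK.
  case: (vertex_case _) => [[]|] /= => [u|u|]; rewrite !is_childE //.
    by rewrite fl0 => /eqP + /eqP => /[swap] ->.
  by move=> _ /eqP->.
(* A child of a vertex of the left subtree stays in the left subtree, so membership propagates from
   its root. *)
have fl u : exists v, f (lvertex r u) = lvertex r' v.
  elim/vertex_child_ind: u => [|u w uw [v fu]]; first by exists (root_vertex l').
  have : is_child (f (lvertex r u)) (f (lvertex r w)) by apply: fc; rewrite is_childE.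
  rewrite fu -[f (lvertex _ w)]vertex_caseK.
  case: (vertex_case _) => [[]|] /= => [v'|v'|]; rewrite !is_childE // => _.
  by exists v'.
have fr u : exists v, f (rvertex l u) = rvertex l' v.
  elim/vertex_child_ind: u => [|u w uw [v fu]]; first by exists (root_vertex r').
  have : is_child (f (rvertex l u)) (f (rvertex l w)) by apply: fc; rewrite is_childE.
  rewrite fu -[f (rvertex _ w)]vertex_caseK.
  case: (vertex_case _) => [[]|] /= => [v'|v'|]; rewrite !is_childE // => _.
  by exists v'.
have [g gE] := fin_all_exists fl; have [h hE] := fin_all_exists fr.
have gI : injective g by move=> u v guv; apply: (@lvertex_inj l r); apply: fI; rewrite !gE guv.
have hI : injective h by move=> u v huv; apply: (@rvertex_inj l r); apply: fI; rewrite !hE huv.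
(* Injectivity gives an inequality on each side, and the totals agree. *)
have [gc hc] : #|vertex l| = #|vertex l'| /\ #|vertex r| = #|vertex r'|.
  have := leq_card g gI; have := leq_card h hI.
  by move: cE; rewrite !card_vertex_Node; lia.
exists (finfun g, finfun h); last first.
  apply/ffunP => x; rewrite -[x]vertex_caseK.
  by case: (vertex_case x) => [[]|] /= => [u|u|]; rewrite ?glue0 ?gluel ?gluer //= ffunE.
apply/setXP; split; apply/isosP; split=> //=; rewrite ?ffunE.
- by move=> u v; rewrite !ffunE => /gI.
- by apply: (@lvertex_inj _ r'); rewrite -gE.
- by move=> u v uv; rewrite !ffunE -(is_child_ll r') -!gE; apply: fc; rewrite is_childE.
- by move=> u v; rewrite !ffunE => /hI.
- by apply: (@rvertex_inj l'); rewrite -hE.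
- by move=> u v uv; rewrite !ffunE -(is_child_rr l') -!hE; apply: fc; rewrite is_childE.
Qed.

End Glue.

Section Swap.
Variables l r : ptree.

Definition vertex_swap (x : vertex (Node l r)) : vertex (Node r l) :=
  vertex_of (match vertex_case x with
    | None => None
    | Some (inl u) => Some (inr u)
    | Some (inr u) => Some (inl u)
    end).

End Swap.

Lemma vertex_swapK l r : cancel (@vertex_swap l r) (@vertex_swap r l).
Proof.
move=> x; rewrite /vertex_swap vertex_ofK -[RHS]vertex_caseK.
by case: (vertex_case x) => [[]|].
Qed.

Lemma is_child_swap l r (x y : vertex (Node l r)) :
  is_child (vertex_swap x) (vertex_swap y) = is_child x y.
Proof.
rewrite -[in RHS](vertex_caseK x) -[in RHS](vertex_caseK y) /vertex_swap.
case: (vertex_case x) => [[]|] => [u|u|]; case: (vertex_case y) => [[]|] => [v|v|] /=;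
  by rewrite !is_childE.
Qed.

Definition comp_swap t l r (f : {ffun vertex t -> vertex (Node l r)}) :
  {ffun vertex t -> vertex (Node r l)} := [ffun x => vertex_swap (f x)].

Lemma comp_swapK t l r : cancel (@comp_swap t l r) (@comp_swap t r l).
Proof. by move=> f; apply/ffunP => x; rewrite !ffunE vertex_swapK. Qed.

Lemma isos_comp_swap t l r (f : {ffun vertex t -> vertex (Node l r)}) :
  (comp_swap f \in isos t (Node r l)) = (f \in isos t (Node l r)).
Proof.
have sub l' r' (g : {ffun vertex t -> vertex (Node l' r')}) :
    g \in isos t (Node l' r') -> comp_swap g \in isos t (Node r' l').
  case/isosP=> gE gI g0 gc; apply/isosP; split.
  - by rewrite gE !card_vertex_Node addnC.
  - by move=> x y; rewrite !ffunE => /(can_inj (@vertex_swapK _ _))/gI.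
  - by rewrite ffunE g0.
  - by move=> x y /gc; rewrite !ffunE is_child_swap.
by apply/idP/idP => [/sub|/sub//]; rewrite comp_swapK.
Qed.

(** The left child goes to the left or to the right child of the target. Swapping the children of
    the target reduces the second case to the first. *)
Lemma card_isos_Node l r l' r' :
  #|isos (Node l r) (Node l' r')| =
  #|isos l l'| * #|isos r r'| + #|isos l r'| * #|isos r l'|.
Proof.
have glueE a b : #|isos l a| * #|isos r b| =
    #|[set f in isos (Node l r) (Node a b) |
       f (lvertex r (root_vertex l)) == lvertex b (root_vertex a)]|.
  by rewrite isos_glue card_imset ?cardsX //; exact: glue_inj.
rewrite -(cardsID [set f : {ffun vertex (Node l r) -> vertex (Node l' r')} |
  f (lvertex r (root_vertex l)) == lvertex r' (root_vertex l')]).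
congr addn; rewrite glueE; first by apply: eq_card => f; rewrite !inE.
rewrite -(@on_card_preimset _ _ (@comp_swap (Node l r) l' r')); last first.
  apply: onW_bij; exists (@comp_swap (Node l r) r' l'); exact: comp_swapK.
apply: eq_card => f; rewrite setIdE inE [RHS]inE in_setI isos_comp_swap.
rewrite andbC; case: (boolP (f \in isos _ _)) => //= /isosP[_ fI f0 fc].
rewrite !inE ffunE; have := fc (root_vertex _) (lvertex r (root_vertex l)).
rewrite f0 is_childE eqxx -[f (lvertex _ _)]vertex_caseK /vertex_swap vertex_ofK.
case: (vertex_case _) => [[]|] /= => [u|u|]; rewrite is_childE => /(_ isT) // /eqP->.
by rewrite eqxx; apply/esym/eqP => /(congr1 val).
Qed.

Lemma isob_Node l r l' r' : isob (Node l r) (Node l' r') =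
  isob l l' && isob r r' || isob l r' && isob r l'.
Proof. by rewrite !isobE card_isos_Node addn_gt0 !muln_gt0. Qed.

Lemma card_vertex_Leaf : #|vertex Leaf| = 1.
Proof. by rewrite card_vertex. Qed.

Lemma isob_card t s : isob t s -> #|vertex t| = #|vertex s|.
Proof. by rewrite isobE => /card_gt0P[f /isosP[]]. Qed.

Lemma isob_Leafl t : isob Leaf t = (t == Leaf).
Proof.
apply/idP/eqP => [/isob_card|->]; last exact: isob_refl.
case: t => // l r; rewrite card_vertex_Node card_vertex_Leaf.
by have := size_addresses_gt0 l; rewrite card_vertex; lia.
Qed.

Lemma isob_Leafr t : isob t Leaf = (t == Leaf).
Proof. by rewrite isob_sym isob_Leafl. Qed.

Lemma card_isos_Leaf : #|isos Leaf Leaf| = 1.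
Proof.
have leaf0 (x : vertex Leaf) : x = root_vertex Leaf.
  by apply: val_inj; have := valP x; rewrite inE => /eqP.
rewrite -(cards1 [ffun x : vertex Leaf => x]); apply: eq_card => f.
rewrite [RHS]inE; apply/idP/eqP => [_|->].
  by apply/ffunP => x; rewrite [LHS]leaf0 [RHS]leaf0.
by apply/isosP; split=> [//|x y|//|x y]; rewrite ?[x]leaf0 [y]leaf0 ?is_childE.
Qed.

(** * Planar trees by number of internal nodes, and the isomorphisms onto them *)

Fixpoint nb_nodes t := if t is Node l r then (nb_nodes l + nb_nodes r).+1 else 0.

(** Places the index [nb_nodes t] in the range of the finite sum that defines [prelie_exp]. *)
Lemma nb_nodes_lt t : nb_nodes t < #|vertex t|.
Proof.
elim: t => [|l IHl r IHr]; first by rewrite card_vertex_Leaf.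
by rewrite card_vertex_Node ltnS /= -addSn leq_add // ltnW.
Qed.

(* The junk value [::] is only reached when fuel < n. *)
Fixpoint ptrees_rec fuel n : seq ptree :=
  match n, fuel with
  | 0, _ => [:: Leaf]
  | m.+1, k.+1 => flatten [seq [seq Node l r | l <- ptrees_rec k i, r <- ptrees_rec k (m - i)]
                          | i <- iota 0 m.+1]
  | _, _ => [::]
  end.

Definition ptrees n := ptrees_rec n n.

Lemma ptrees_recE fuel n : n <= fuel -> ptrees_rec fuel n = ptrees n.
Proof.
suff eq k m i : i <= k -> i <= m -> ptrees_rec k i = ptrees_rec m i by move=> ?; apply: eq.
elim: k m i => [|k IHk] [|m] [|i] // ik im.
congr flatten; apply/eq_in_map => j; rewrite mem_iota => /andP[_ ji].
by rewrite -/ptrees_rec !(IHk m) //; lia.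
Qed.

Lemma big_ptrees0 V (idx : V) (op : Monoid.law idx) (F : ptree -> V) :
  \big[op/idx]_(t <- ptrees 0) F t = F Leaf.
Proof. by rewrite big_seq1. Qed.

(** The Catalan recursion: besides the root, [i] internal nodes lie on the left and [n - i] on the
    right. *)
Lemma big_ptreesS V (idx : V) (op : Monoid.law idx) (F : ptree -> V) n :
  \big[op/idx]_(t <- ptrees n.+1) F t =
  \big[op/idx]_(i < n.+1) \big[op/idx]_(l <- ptrees i)
    \big[op/idx]_(r <- ptrees (n - i)) F (Node l r).
Proof.
have -> : ptrees n.+1 =
    flatten [seq [seq Node l r | l <- ptrees_rec n i, r <- ptrees_rec n (n - i)]
            | i <- index_iota 0 n.+1] by [].
rewrite big_flatten big_map big_mkord; apply: eq_bigr => i _.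
rewrite big_allpairs_dep /=.
by have := ltn_ord i; rewrite ltnS => i_n; rewrite !ptrees_recE ?leq_subr.
Qed.

(** Each of the two products in [card_isos_Node] contributes the product of the counts for the
    subtrees, which yields one more factor 2 per internal node. *)
Lemma sum_isos t n : \sum_(s <- ptrees n) #|isos t s| = (n == nb_nodes t) * 2 ^ n.
Proof.
have isos0 l r : #|isos Leaf (Node l r)| = 0.
  by apply/eqP; rewrite -leqn0 leqNgt -isobE isob_Leafl.
have isos0' l r : #|isos (Node l r) Leaf| = 0.
  by apply/eqP; rewrite -leqn0 leqNgt -isobE isob_Leafr.
elim: t n => [|l IHl r IHr] [|n].
- by rewrite big_ptrees0 card_isos_Leaf.
- by rewrite big_ptreesS big1 // => i _; rewrite !big1_seq // => ? _; rewrite big1_seq.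
- by rewrite big_ptrees0 isos0'.
rewrite big_ptreesS /=.
(* Used twice, for the straight and for the crossed matching of the subtrees; only the index
   [i = nb_nodes a] survives. *)
have half a b : (forall m, \sum_(s <- ptrees m) #|isos a s| = (m == nb_nodes a) * 2 ^ m) ->
    (forall m, \sum_(s <- ptrees m) #|isos b s| = (m == nb_nodes b) * 2 ^ m) ->
    \sum_(i < n.+1) \sum_(u <- ptrees i) \sum_(v <- ptrees (n - i)) #|isos a u| * #|isos b v|
    = (n == nb_nodes a + nb_nodes b) * 2 ^ n.
  move=> aE bE.
  have summand (i : 'I_n.+1) :
      \sum_(u <- ptrees i) \sum_(v <- ptrees (n - i)) #|isos a u| * #|isos b v| =
      (nat_of_ord i == nb_nodes a) * ((n == nb_nodes a + nb_nodes b) * 2 ^ n).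
    rewrite -big_distrlr aE bE /=.
    have [ia|] := eqVneq (nat_of_ord i) (nb_nodes a); last by [].
    rewrite (_ : (n - i == _) = (n == nb_nodes a + nb_nodes b)); last first.
      by have := ltn_ord i; lia.
    by rewrite !mul1n mulnCA -expnD subnKC // -ltnS.
  rewrite (eq_bigr _ (fun i _ => summand i)) -big_distrl /=.
  have [nE|] := eqVneq n (nb_nodes a + nb_nodes b); last by rewrite !mul0n muln0.
  have an : nb_nodes a < n.+1 by lia.
  by rewrite (bigD1 (Ordinal an)) //= eqxx big1 ?mul1n // => i; rewrite -val_eqE /= => /negPf->.
under eq_bigr do under eq_bigr do under eq_bigr do rewrite card_isos_Node.
under eq_bigr do under eq_bigr do rewrite big_split.
under eq_bigr do rewrite big_split.
rewrite big_split /= half //.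
under [X in _ + X]eq_bigr do under eq_bigr do under eq_bigr do rewrite mulnC.
rewrite half // eqSS [nb_nodes r + _]addnC expnS.
by case: eqP => _; lia.
Qed.

Local Open Scope ring_scope.

(** * Grafting a leaf, and Remy's identity *)

Section Grafts.
Variable V : nmodType.
Implicit Type F : ptree -> V.

(** These are the functions on [btree]; keeping them on planar trees allows structural induction. *)
Definition isob_invariant F := forall t s, isob t s -> F t = F s.

(* With F t = <<t>>, this is the operator N of the paper: the address [::]
   contributes the term M(t, bullet), the others the edge insertions. *)
Definition graft_sum F t := \sum_(p <- addresses t) F (split_above t p Leaf).

Lemma graft_sum_Leaf F : graft_sum F Leaf = F (Node Leaf Leaf).
Proof. by rewrite /graft_sum big_seq1. Qed.

Lemma graft_sum_Node F l r : graft_sum F (Node l r) =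
  F (Node (Node l r) Leaf) +
  (graft_sum (fun t => F (Node t r)) l + graft_sum (fun t => F (Node l t)) r).
Proof. by rewrite /graft_sum /= big_cons big_cat !big_map. Qed.

Lemma invariant_Nodel F r : isob_invariant F -> isob_invariant (fun t => F (Node t r)).
Proof. by move=> FI t s ts; apply: FI; rewrite isob_Node ts isob_refl. Qed.

Lemma invariant_Noder F l : isob_invariant F -> isob_invariant (fun t => F (Node l t)).
Proof. by move=> FI t s ts; apply: FI; rewrite isob_Node ts isob_refl. Qed.

Lemma invariant_NodeC F l r : isob_invariant F -> F (Node l r) = F (Node r l).
Proof. by move=> FI; apply: FI; rewrite isob_Node !isob_refl orbT. Qed.

(** Grafting thus descends to isomorphism classes. [F] varies in the induction, since each recursive
    call fixes one sibling. A crossed matching of subtrees exchanges the two recursive sums. *)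
Lemma graft_sum_invariant F : isob_invariant F -> isob_invariant (graft_sum F).
Proof.
move=> + t; elim: t F => [|l IHl r IHr] F FI [|l' r'];
  rewrite ?isob_Leafl ?isob_Leafr // => ts.
rewrite !graft_sum_Node (FI _ (Node (Node l' r') Leaf)); last first.
  by rewrite isob_Node ts isob_refl.
rewrite isob_Node in ts; congr (_ + _); case/orP: ts => /andP[ll rr].
  rewrite (IHl _ (invariant_Nodel r FI) _ ll) (IHr _ (invariant_Noder l FI) _ rr).
  congr (_ + _); apply: eq_bigr => p _; apply: FI;
    by rewrite isob_Node !isob_refl ?ll ?rr.
rewrite (IHl _ (invariant_Nodel r FI) _ ll) (IHr _ (invariant_Noder l FI) _ rr) addrC.
congr (_ + _); apply: eq_bigr => p _; apply: FI;
  by rewrite isob_Node !isob_refl ?ll ?rr orbT.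
Qed.

(* Remy's identity; the factor 2 accounts for the side on which the leaf is
   grafted, which F does not see. *)
Lemma sum_graft_sum F n : isob_invariant F ->
  (\sum_(u <- ptrees n) graft_sum F u) *+ 2 = (\sum_(t <- ptrees n.+1) F t) *+ n.+2.
Proof.
elim/ltn_ind: n F => -[|n] IHn F FI.
  by rewrite big_ptrees0 graft_sum_Leaf big_ptreesS big_ord1 !big_ptrees0.
(* The sum over trees whose subtrees have [i] and [j] internal nodes; invariance of [F] makes it
   symmetric. *)
pose B i j := \sum_(l <- ptrees i) \sum_(r <- ptrees j) F (Node l r).
have BC i j : B i j = B j i.
  rewrite /B exchange_big; apply: eq_bigr => r _; apply: eq_bigr => l _.
  exact: invariant_NodeC.
rewrite !big_ptreesS -/(B _ _).
under eq_bigr do under eq_bigr do under eq_bigr do rewrite graft_sum_Node.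
under eq_bigr do under eq_bigr do rewrite !big_split /=.
under eq_bigr do rewrite !big_split /=.
rewrite !big_split /= !mulrnDl.
rewrite -(big_ptreesS _ (fun t => F (Node t Leaf))).
have -> : \sum_(t <- ptrees n.+1) F (Node t Leaf) = B n.+1 0%N.
  by apply: eq_bigr => t _; rewrite big_ptrees0.
(* The induction hypothesis with [r] fixed; the weight is the number of leaves of the enlarged left
   subtree. *)
have -> : (\sum_(i < n.+1) \sum_(l <- ptrees i) \sum_(r <- ptrees (n - i))
    graft_sum (fun t => F (Node t r)) l) *+ 2 = \sum_(i < n.+1) B i.+1 (n - i)%N *+ i.+2.
  rewrite -sumrMnl; apply: eq_bigr => i _.
  rewrite exchange_big -sumrMnl [B _ _]exchange_big -sumrMnl; apply: eq_bigr => r _.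
  by apply: IHn; [exact: ltn_ord|exact: invariant_Nodel].
have -> : (\sum_(i < n.+1) \sum_(l <- ptrees i) \sum_(r <- ptrees (n - i))
    graft_sum (fun t => F (Node l t)) r) *+ 2 = \sum_(i < n.+1) B i (n.+1 - i)%N *+ (n.+1 - i).+1.
  rewrite -sumrMnl; apply: eq_bigr => i _.
  rewrite -!sumrMnl; apply: eq_bigr => l _; rewrite subSn -1?ltnS //.
  by apply: IHn; [rewrite ltnS leq_subr|exact: invariant_Noder].
(* By symmetry of [B], the doubled root term supplies the missing end terms: [i = 0] in the first
   sum and [i = n.+1] in the second. The weights at each [i] then add up to [n.+3], the total number
   of leaves. *)
transitivity (\sum_(i < n.+2) B i (n.+1 - i)%N *+ i.+1 +
              \sum_(i < n.+2) B i (n.+1 - i)%N *+ (n.+1 - i).+1).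
  rewrite [X in _ = X + _]big_ord_recl [X in _ = _ + X]big_ord_recr /= subnn subn0.
  rewrite [B 0%N _]BC.
  rewrite mulr2n !mulr1n addrACA [_ + B n.+1 0%N]addrC.
  by rewrite -!addrA; congr (_ + _); rewrite addrCA.
rewrite -big_split /= -sumrMnl; apply: eq_bigr => i _; rewrite -mulrnDr.
by congr (_ *+ _); have := ltn_ord i; lia.
Qed.

End Grafts.

(** * The pre-Lie product with the single vertex, on isomorphism classes *)

Lemma isob_repr t : isob (repr (\pi_btree t)%qT) t.
Proof. by rewrite -(pi_eq_quot (s := btree)) reprK. Qed.

Lemma pi_eqE t T : ((\pi_btree t)%qT == T) = isob t (repr T).
Proof. by rewrite -{1}(reprK T) pi_eq_quot. Qed.

Lemma repr_bullet : repr bullet = Leaf.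
Proof. by apply/eqP; rewrite -isob_Leafr; exact: isob_repr. Qed.

(** Every vertex other than the root is the lower end of exactly one edge, so the root address
    completes the edges to all addresses. *)
Lemma sum_edges (V : nmodType) t (G : seq bool -> V) :
  G [::] + \sum_(e in edges t) G (val e.2) = \sum_(p <- addresses t) G p.
Proof.
have -> : \sum_(p <- addresses t) G p = \sum_(x : vertex t) G (val x).
  rewrite -[in LHS](val_seq_sub_enum (addresses_uniq t)) big_map.
  apply: perm_big; apply: uniq_perm; rewrite ?index_enum_uniq //.
    by rewrite -(map_inj_uniq val_inj) val_seq_sub_enum addresses_uniq.
  by move=> x; rewrite mem_index_enum mem_seq_sub_enum.
rewrite (bigD1 (root_vertex t)) //=; congr (_ + _).
rewrite (eq_bigl (fun e => is_child e.1 e.2)); last by move=> e; rewrite inE.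
rewrite -(pair_big_dep xpredT (fun x y => is_child x y) (fun x y => G (val y))) /=.
rewrite (exchange_big_dep xpredT) //= [RHS]big_mkcond; apply: eq_bigr => y _.
by rewrite sumr_const card_parents; case: (y != _).
Qed.

Section PrelieBullet.
Variable k : fieldType.

Definition basis_pi (t : ptree) : {malg k[btree]} := << (\pi_btree t)%qT >>.

Lemma basis_pi_invariant : isob_invariant basis_pi.
Proof. by move=> t s; rewrite -(pi_eq_quot (s := btree)) /basis_pi => /eqP->. Qed.

Lemma prelie_basis_bullet T : prelie_basis k T bullet = graft_sum basis_pi (repr T).
Proof.
rewrite /prelie_basis /join_trees /insert_at repr_bullet.
have -> : Node (repr T) Leaf = split_above (repr T) [::] Leaf by case: (repr T).
by rewrite /graft_sum -sum_edges.
Qed.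

(** Allowing any finite set that contains the support lets linearity be checked over a common index
    set. *)
Lemma prelie_bulletE (d : {fset btree}) (z : {malg k[btree]}) : (msupp z `<=` d)%fset ->
  prelie z << bullet >> = \sum_(T <- d) z@_T *: graft_sum basis_pi (repr T).
Proof.
move=> zd; rewrite /prelie (big_fset_incl _ zd) => [|T _ /mcoeff_outdom zT].
  apply: eq_bigr => T _; rewrite msuppU oner_eq0 big_seq_fset1 mcoeffUU mulr1.
  by rewrite prelie_basis_bullet.
by apply: big1 => S _; rewrite zT mul0r scale0r.
Qed.

Lemma prelie_bullet_linear c (x y : {malg k[btree]}) :
  prelie (c *: x + y) << bullet >> = c *: prelie x << bullet >> + prelie y << bullet >>.
Proof.
pose d := (msupp (c *: x + y) `|` (msupp x `|` msupp y))%fset.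
rewrite !(@prelie_bulletE d) /d ?fsubsetUl // 1?fsubsetU ?fsubsetUr ?fsubsetUl ?orbT //.
rewrite scaler_sumr -big_split; apply: eq_bigr => T _ /=.
by rewrite mcoeffD mcoeffZ scalerDl scalerA.
Qed.

(** The chosen representative of the class may differ from [t], which the invariance of [graft_sum]
    absorbs. *)
Lemma prelie_bullet_pi t : prelie (basis_pi t) << bullet >> = graft_sum basis_pi t.
Proof.
rewrite (@prelie_bulletE [fset (\pi_btree t)%qT]%fset) ?msuppU ?oner_eq0 //.
rewrite big_seq_fset1 mcoeffUU scale1r.
exact/(graft_sum_invariant basis_pi_invariant)/isob_repr.
Qed.

(** Keeping [2 ^ n] on the left avoids division: at each step the new factor 2 is traded, by Remy's
    identity, for the factor [n.+2] that extends the factorial. *)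
Lemma prelie_pow_bullet n : prelie_pow (<< bullet >> : {malg k[btree]}) n *+ 2 ^ n =
  (\sum_(t <- ptrees n) basis_pi t) *+ n.+1`!.
Proof.
have N0 : prelie 0 << bullet >> = 0 :> {malg k[btree]}.
  by rewrite (@prelie_bulletE fset0) ?msupp0 // big_seq_fset0.
have ND (x y : {malg k[btree]}) :
    prelie (x + y) << bullet >> = prelie x << bullet >> + prelie y << bullet >>.
  by have := prelie_bullet_linear 1 x y; rewrite !scale1r.
have NMn m (x : {malg k[btree]}) : prelie (x *+ m) << bullet >> = prelie x << bullet >> *+ m.
  by elim: m => [|m IHm]; rewrite ?mulr0n // !mulrS ND IHm.
elim: n => [|n IHn]; first by rewrite big_ptrees0 mulr1n.
rewrite /= -/(prelie_pow _ n) expnSr mulrnA -NMn IHn NMn.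
rewrite (big_morph _ ND N0) (eq_bigr _ (fun t _ => prelie_bullet_pi t)).
rewrite -mulrnAC sum_graft_sum; last exact: basis_pi_invariant.
by rewrite -mulrnA [in RHS]factS mulnC.
Qed.

End PrelieBullet.

(** * The coefficient of a tree in the exponential of the single vertex *)

Unset Implicit Arguments.

Theorem proposition5p2 (k : fieldType) (k_char0 : [pchar k] =i pred0)
    (T : btree) :
  prelie_exp (<< bullet >> : {malg k[btree]}) T = (nb_aut T)%:R^-1.
Proof.
have nat_neq0 m : (0 < m)%N -> m%:R != 0 :> k.
  by move=> m_gt0; rewrite ((pcharf0P k).1 k_char0) -lt0n.
(* [c n] counts the planar trees with [n] internal nodes in the class of [T]. *)
pose t := repr T; pose c n := (\sum_(s <- ptrees n) isob t s)%N.
have aut_neq0 : (nb_aut T)%:R != 0 :> k.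
  by apply: nat_neq0; rewrite /nb_aut card_automorphisms -isobE isob_refl.
(* Each such planar tree receives as many isomorphisms from [t] as [t] has automorphisms. *)
have cE n : (c n * nb_aut T = (n == nb_nodes t) * 2 ^ n)%N.
  by rewrite -sum_isos big_distrl; apply: eq_bigr => s _; rewrite card_isos.
have powE n : (prelie_pow (<< bullet >> : {malg k[btree]}) n)@_T * (2 ^ n)%:R
    = (c n)%:R * (n.+1)`!%:R.
  rewrite !mulr_natr -!mcoeffMn prelie_pow_bullet !mcoeffMn raddf_sum natr_sum.
  congr (_ *+ _); apply: eq_bigr => s _ /=.
  by rewrite mcoeffU pi_eqE isob_sym.
(* Characteristic 0 allows cancelling the factorial, [2 ^ n] and [nb_aut T]; only the term of index
   [nb_nodes t] is nonzero. *)
have termE n : ((n.+1)`!%:R^-1 *: prelie_pow (<< bullet >> : {malg k[btree]}) n)@_T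
    = (n == nb_nodes t)%:R / (nb_aut T)%:R.
  have two_neq0 : (2 ^ n)%:R != 0 :> k by apply: nat_neq0; rewrite expn_gt0.
  rewrite mcoeffZ; apply: (mulIf two_neq0); rewrite -mulrA powE mulrCA.
  rewrite mulVf ?nat_neq0 ?fact_gt0 // mulr1; apply: (mulIf aut_neq0).
  by rewrite -natrM cE natrM mulrAC divfK.
rewrite /prelie_exp; under eq_bigr do rewrite termE.
rewrite -mulr_suml.
rewrite (bigD1 (Ordinal (nb_nodes_lt t))) //= eqxx big1 ?addr0 ?mul1r // => i.
by rewrite -val_eqE /= => /negPf->.
Qed.
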